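(* Let $p$ be a prime and $m\ge1$ with $p^m\equiv 3\pmod 4$, and write $v=p^m$. Let $D$ be a skew Hadamard difference set in the additive group $\mathbb{Z}_p^m$, let $D^*=\{a\in\mathbb{Z}_p^m\mid \chi_a(D)=\frac{-1+\sqrt{-v}}{2}\}$ be its dual set, and let $G=\mathbb{Z}_p^m\times\mathbb{Z}_p^m$ with isomorphism $\Delta:G\to\widehat G$, $(a,b)\mapsto\chi_{a,b}$, where $\chi_{a,b}(x,y)=\chi_a(x)\chi_b(y)$. Let $\alpha,\beta$ be nonzero elements of $\mathbb{Z}_p$ with $\alpha\ne\beta$. Define $$S=\{(0,0)\}\cup\{(x,\alpha x)\mid x\in D\}\cup\{(x,\beta x)\mid x\in -D\}$$ and $$T=\{(0,0)\}\cup\Big\{\big(\tfrac{\alpha}{\alpha-\beta}x,\tfrac{1}{\beta-\alpha}x\big)\ \Big|\ x\in D^*\Big\}\cup\Big\{\big(\tfrac{\beta}{\alpha-\beta}x,\tfrac{1}{\beta-\alpha}x\big)\ \Big|\ x\in -D^*\Big\}.$$ Then $S$ and $T$ form a primitive formally dual pair in $G$.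
   Context: For $a\in\mathbb{Z}_p^m$, $\chi_a(x)=\zeta_p^{a\cdot x}$ where $a\cdot x$ is the usual inner product and $\zeta_p$ a primitive $p$-th root of unity; $\sqrt{-v}$ denotes $\sqrt{-1}\sqrt{v}$; $\chi(A)=\sum_{x\in A}\chi(x)$. A $k$-subset $D$ of a group $G$ of order $v$ is a $(v,k,\lambda)$ difference set if every nonidentity element of $G$ is expressible as $d_1-d_2$ ($d_1,d_2\in D$) exactly $\lambda$ times; it is skew Hadamard if moreover $\{0\}$, $D$, $-D$ partition $G$. For $A\subseteq G$, $\nu_A(g)=|\{(a_1,a_2)\in A\times A\mid g=a_1-a_2\}|$. $S,T\subseteq G$ form a formally dual pair under $\Delta$ ($y\mapsto\chi_y$) if for all $y\in G$: $|\chi_y(S)|^2=\frac{|S|^2}{|T|}\nu_T(y)$ and $|\chi_y(T)|^2=\frac{|T|^2}{|S|}\nu_S(y)$. A subset is primitive if it is not contained in a coset of a proper subgroup and is not a union of cosets of a nontrivial subgroup; the pair is primitive if both sets are primitive. *)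

(* Defs.v *)
From HB Require Import structures.
From mathcomp Require Import all_boot all_order all_algebra.
From mathcomp Require Import all_field.

Set Implicit Arguments.
Unset Strict Implicit.
Unset Printing Implicit Defensive.

Import GRing.Theory Num.Theory.
Local Open Scope ring_scope.

Section FiniteAbelianGroups.

Variable G : finZmodType.
Implicit Types (A D S T : {set G}) (g : G).

Definition nu A g : nat :=
  #|[set u in setX A A | g == u.1 - u.2]|.

Definition opp_set A : {set G} := [set - x | x in A].

Definition difference_set (v k lambda : nat) D : Prop :=
  [/\ #|G| = v, #|D| = k & forall g, g != 0 -> nu D g = lambda].

(* Disjointness is spelled out because [partition [set [set 0]; D; opp_set D]]
   would also hold for D = G \ {0}, where D and -D coincide as blocks. *)
Definition skew_hadamard D : Prop :=
  [/\ exists k lambda : nat, difference_set #|G| k lambda D,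
      0 \notin D,
      0 \notin opp_set D,
      [disjoint D & opp_set D]
    & [set 0] :|: D :|: opp_set D = [set: G]].

Definition char_sum (chi : G -> algC) A : algC := \sum_(x in A) chi x.

(* Delta maps y to the character chi_y. *)
Definition formally_dual_pair (Delta : G -> G -> algC) S T : Prop :=
  forall y : G,
    `|char_sum (Delta y) S| ^+ 2 = #|S|%:R ^+ 2 / #|T|%:R * (nu T y)%:R /\
    `|char_sum (Delta y) T| ^+ 2 = #|T|%:R ^+ 2 / #|S|%:R * (nu S y)%:R.

Definition coset_add (H : {set G}) g : {set G} := [set h + g | h in H].

(* [zmod_closed H] states that H is an additive subgroup of G. *)
Definition primitive_set A : Prop :=
  (forall (H : {set G}) g, zmod_closed H -> H \proper [set: G] ->
     ~~ (A \subset coset_add H g)) /\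
  (forall H B : {set G}, zmod_closed H -> H != [set 0] ->
     A != \bigcup_(g in B) coset_add H g).

Definition primitive_formally_dual_pair (Delta : G -> G -> algC) S T : Prop :=
  [/\ formally_dual_pair Delta S T, primitive_set S & primitive_set T].

End FiniteAbelianGroups.

(* Products of finZmodTypes have zmodType and finType structures, but the join
   of the two is not declared in the library. *)
HB.instance Definition _ (U V : finZmodType) := GRing.Zmodule.on (U * V)%type.

Section ElementaryAbelian.

(* 'rV['F_p]_m is Z_p^m when p is prime; zeta is a primitive p-th root of 1. *)
Variables (p m : nat) (zeta : algC).
Implicit Types (a x : 'rV['F_p]_m) (D : {set 'rV['F_p]_m}).

Definition dotv a x : 'F_p := \sum_(i < m) a 0 i * x 0 i.

Definition chi a x : algC := zeta ^+ (dotv a x : nat).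

Definition dual_set D : {set 'rV['F_p]_m} :=
  [set a | char_sum (chi a) D == (-1 + 'i * sqrtC (p ^ m)%N%:R) / 2].

Definition chi2 (ab xy : 'rV['F_p]_m * 'rV['F_p]_m) : algC :=
  chi ab.1 xy.1 * chi ab.2 xy.2.

End ElementaryAbelian.

(* Main.v *)
Require Import Defs.
From HB Require Import structures.
From mathcomp Require Import all_boot all_order all_algebra.
From mathcomp Require Import all_field.
From mathcomp Require Import zify ring.

Set Implicit Arguments.
Unset Strict Implicit.
Unset Printing Implicit Defensive.

Import GRing.Theory Num.Theory.
Local Open Scope ring_scope.

(* Write E for the dual set D* and s_A = 1_A - 1_{-A}. For a skew Hadamard
   difference set D, (2 chi_a(D) + 1)^2 = -v for a <> 0, so the Fourier transform
   of s_D is sqrt(-v) s_E; by Fourier inversion that of s_E is sqrt(-v) s_D,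
   which gives chi_a(E) for all a.
   Both S and T are crosses {0} u f(A) u g(B), where f and g embed Z_p^m onto
   complementary subgroups of G and A, B each contain exactly one of x and -x
   for x <> 0. At y = f a + g b, with f and g those of S, nu_S(y) is a direct
   count and chi_y(T) = 1 + chi_a(E) + chi_b(E), which yields the second duality
   equation; the first one is its Fourier transform. A cross X is primitive
   because X u -X contains both summands while X n -X = {0}. *)

(** * Counting differences in a finite abelian group *)

Lemma nuE (G : finZmodType) (A : {set G}) g :
  nu A g = (\sum_(x in A) ((x + g)%R \in A))%N.
Proof.
rewrite -big_mkcondr sum1_card /nu.
have -> : [set u in setX A A | g == u.1 - u.2] =
    [set (x + g, x) | x in [set x in A | x + g \in A]].
  apply/setP => -[x y]; rewrite !inE /=; apply/idP/imsetP => /=.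
    case/andP=> /andP[Ax Ay] /eqP ->; exists y; last by rewrite addrC subrK.
    by rewrite !inE Ay addrC subrK.
  by case=> z; rewrite inE => /andP[Az Azg] [-> ->]; rewrite Az Azg addrAC subrr add0r eqxx.
by rewrite card_imset => [|x y [_ ->] //]; apply/eq_card => x; rewrite !inE.
Qed.

Lemma nu0 (G : finZmodType) (A : {set G}) : nu A 0 = #|A|.
Proof.
by rewrite nuE -sum1_card; apply: eq_bigr => x Ax; rewrite addr0 Ax.
Qed.

Lemma sum_nu (G : finZmodType) (A : {set G}) : (\sum_g nu A g = #|A| ^ 2)%N.
Proof.
under eq_bigr do rewrite nuE.
rewrite exchange_big /= -mulnn -sum_nat_const; apply: eq_bigr => x _.
rewrite (reindex_inj (addIr (- x))) /= -sum1_card [RHS]big_mkcond.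
by apply: eq_bigr => z _; rewrite addrC subrK; case: ifP.
Qed.

Lemma mem_opp_set (G : finZmodType) (A : {set G}) x :
  (x \in opp_set A) = (- x \in A).
Proof. by rewrite /opp_set -{1}[x]opprK mem_imset //; exact: oppr_inj. Qed.

(** The pairs $(a_1,a_2)$ and $(-a_2,-a_1)$ have the same difference. *)
Lemma nu_opp_set (G : finZmodType) (A : {set G}) g :
  nu (opp_set A) g = nu A g.
Proof.
rewrite !nuE big_mkcond [RHS]big_mkcond /=.
rewrite (reindex_inj (inj_comp (addIr (- g)) oppr_inj)) /=.
apply: eq_bigr => x _; rewrite !mem_opp_set subrK opprK opprB opprK [g + x]addrC.
by do 2!case: (_ \in A).
Qed.

(** * Fourier analysis for a symmetric pairing on a finite abelian group *)

Section Bicharacter.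

Variables (G : finZmodType) (e : G -> G -> algC).

(** Symmetry lets the group serve as its own dual, so a transform is again a function on [G] and can
    be transformed a second time. *)
Definition bicharacter : Prop :=
  [/\ forall y x x', e y (x + x') = e y x * e y x',
      forall x y, e y x = e x y,
      forall y x, e y (- x) = (e y x)^*,
      forall y, e y 0 = 1
    & forall y, y != 0 -> exists x, e y x != 1].

Definition fourier (F : G -> algC) (y : G) : algC := \sum_x F x * e y x.

Hypothesis e_bichar : bicharacter.

(** Translating the summation variable by some [x0] with [e y x0 != 1] multiplies the sum by
    [e y x0], so it vanishes for nonzero [y]. *)
Lemma sum_bicharacter y : \sum_x e y x = #|G|%:R * (y == 0)%:R.
Proof.
case: e_bichar => eD eC _ e0 e_nondeg.
have [->|/e_nondeg[x0 /negPf ex0_neq1]] := eqVneq y 0.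
  rewrite mulr1 -sum1_card natr_sum; apply: eq_bigr => x _.
  by rewrite eC e0.
rewrite mulr0; set s := \sum_x _.
have: s = s * e y x0.
  rewrite /s {1}(reindex_inj (addIr x0)) mulr_suml.
  by apply: eq_bigr => x _; rewrite eD.
move/eqP; rewrite -subr_eq0 -{1}[s]mulr1 -mulrBr mulf_eq0 subr_eq0.
by rewrite [1 == _]eq_sym ex0_neq1 orbF => /eqP.
Qed.

Lemma fourier_inversion F x : fourier (fourier F) (- x) = #|G|%:R * F x.
Proof.
case: e_bichar => eD eC _ _ _; rewrite {1}/fourier /fourier.
under eq_bigr do rewrite mulr_suml.
have sumE z : \sum_y F z * e y z * e (- x) y = F z * (#|G|%:R * (z == x)%:R).
  under eq_bigr do rewrite -mulrA [e (- x) _]eC -eD eC.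
  by rewrite -mulr_sumr sum_bicharacter subr_eq0.
rewrite exchange_big (bigD1 x) //= sumE eqxx mulr1 mulrC big1 ?addr0 // => z.
by move/negPf => z_neq_x; rewrite sumE z_neq_x !mulr0.
Qed.

(** Expand $|\chi_y(A)|^2$ as a double sum of $\chi_y(a_1-a_2)$ and group the pairs by their
    difference. *)
Lemma fourier_nu A y :
  fourier (fun g => (nu A g)%:R) y = `|char_sum (e y) A| ^+ 2.
Proof.
case: e_bichar => eD _ eN _ _; rewrite /fourier normCK /char_sum rmorph_sum mulr_sumr.
under eq_bigr do rewrite nuE natr_sum mulr_suml.
rewrite exchange_big; apply: eq_bigr => x _.
rewrite (reindex_inj (addIr (- x))) /= mulr_suml [RHS]big_mkcond.
apply: eq_bigr => z _; rewrite addrC subrK eD eN.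
by case: (z \in A); rewrite ?mul1r ?mul0r.
Qed.

Lemma char_sumN A y : char_sum (e (- y)) A = (char_sum (e y) A)^*.
Proof.
case: e_bichar => _ eC eN _ _; rewrite /char_sum rmorph_sum.
by apply: eq_bigr => x _; rewrite eC eN eC.
Qed.

Lemma char_sum_opp_set A y : char_sum (e y) (opp_set A) = char_sum (e (- y)) A.
Proof.
case: e_bichar => _ eC eN _ _; rewrite /char_sum big_imset /=.
  by apply: eq_bigr => x _; rewrite eN [RHS]eC eN eC.
by move=> x z _ _; exact: oppr_inj.
Qed.

(** By [fourier_nu] the hypothesis says that the transform of $\nu_T$ is $\frac{|T|^2}{|S|}\nu_S$.
    Transforming once more gives $|G|\,\nu_T$ by inversion and $\frac{|T|^2}{|S|}|\chi(S)|^2$ by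
    [fourier_nu]; $|S||T|=|G|$ makes the constants agree. *)
Lemma formally_dual_pair_half (S T : {set G}) :
  (0 < #|S|)%N -> (0 < #|T|)%N -> (#|S| * #|T|)%N = #|G| ->
  (forall y, `|char_sum (e y) T| ^+ 2 = #|T|%:R ^+ 2 / #|S|%:R * (nu S y)%:R) ->
  formally_dual_pair e S T.
Proof.
move=> S_gt0 T_gt0 cardG TS y; split=> //.
have S_neq0 : #|S|%:R != 0 :> algC by rewrite pnatr_eq0 -lt0n.
have T_neq0 : #|T|%:R != 0 :> algC by rewrite pnatr_eq0 -lt0n.
have := fourier_inversion (fun g => (nu T g)%:R) y.
have -> : fourier (fourier (fun g => (nu T g)%:R)) (- y)
   = #|T|%:R ^+ 2 / #|S|%:R * `|char_sum (e y) S| ^+ 2.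
  rewrite -norm_conjC -char_sumN -fourier_nu /fourier mulr_sumr.
  by apply: eq_bigr => x _; rewrite -/(fourier _ x) fourier_nu TS mulrA.
rewrite -cardG natrM => eqST.
have {eqST} := congr1 ( *%R (#|S|%:R / #|T|%:R ^+ 2)) eqST.
rewrite [LHS]mulrA => eqST.
transitivity (#|S|%:R / #|T|%:R ^+ 2 * (#|T|%:R ^+ 2 / #|S|%:R) * `|char_sum (e y) S| ^+ 2).
  by field; rewrite S_neq0.
by rewrite eqST; field.
Qed.

End Bicharacter.

(** * Skew sets, skew Hadamard difference sets and their duals *)

Section SkewSets.

Variables (V : finZmodType) (e : V -> V -> algC).
Hypothesis e_bichar : bicharacter e.
Implicit Types A D : {set V}.

(* Booleans as integers: 0 is not in A, and if x is nonzero then exactly one of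
   x and -x is in A. *)
Definition skew_set A : Prop :=
  forall x, ((x \in A) + (- x \in A) = (x != 0%R))%N.

Definition sgn A x : algC := (x \in A)%:R - (- x \in A)%:R.

Lemma sgnN A x : sgn A (- x) = - sgn A x.
Proof. by rewrite /sgn opprK opprB. Qed.

Lemma fourier_sgnN A y : fourier e (sgn A) (- y) = - fourier e (sgn A) y.
Proof.
case: e_bichar => _ eC eN _ _.
rewrite /fourier [LHS](reindex_inj oppr_inj) -sumrN; apply: eq_bigr => x _.
by rewrite sgnN eN eC eN conjCK eC mulNr.
Qed.

Lemma skew0 A : skew_set A -> 0 \notin A.
Proof. by move/(_ 0); rewrite oppr0 eqxx; case: (_ \in A). Qed.

Lemma skewN A x : skew_set A -> x != 0 -> (- x \in A) = (x \notin A).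
Proof. by move/(_ x) => + x_neq0; rewrite x_neq0; do 2!case: (_ \in A). Qed.

Lemma skew_opp_set A : skew_set A -> skew_set (opp_set A).
Proof. by move=> skA x; rewrite !mem_opp_set addnC opprK skA. Qed.

Lemma card_skew A : skew_set A -> #|V| = (#|A|.*2.+1)%N.
Proof.
move=> skA; have: (\sum_x ((x \in A) + (- x \in A)) = \sum_(x : V) (x != 0%R))%N.
  by apply: eq_bigr => x _; exact: skA.
rewrite big_split /= [in X in (_ + X)%N](reindex_inj oppr_inj) /=.
under [in X in (_ + X)%N]eq_bigr do rewrite opprK.
rewrite -!big_mkcond /= !sum1_card addnn => ->.
rewrite -cardsT (cardsD1 0) inE add1n; congr _.+1.
by apply/eq_card => x; rewrite !inE andbT.
Qed.

(** This is the transform of the pointwise identity $2\cdot 1_A = 1 - 1_{\{0\}} + s_A$. *)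
Lemma skew_char_sum A y : skew_set A ->
  2 * char_sum (e y) A = #|V|%:R * (y == 0)%:R - 1 + fourier e (sgn A) y.
Proof.
case: (e_bichar) => eD eC _ e0 _ skA.
have ->: -1 = - (\sum_x (x == 0)%:R * e y x).
  rewrite (bigD1 0) //= eqxx e0 mulr1 big1 ?addr0 // => x /negPf ->.
  by rewrite mul0r.
rewrite -(sum_bicharacter e_bichar) -sumrB -big_split /= mulr_sumr big_mkcond.
apply: eq_bigr => x _; rewrite /sgn; have := skA x.
by case: (_ \in A); case: (_ \in A); case: eqP => //= _ _; ring.
Qed.

(** Transforming twice gives $|V|s_A(-y) = -|V|s_A(y) = c^2 s_A(y)$, as $s_A$ is odd; one factor $c$
    cancels. *)
Lemma fourier_sgn_dual A A' c :
  c ^+ 2 = - #|V|%:R -> (forall y, fourier e (sgn A) y = c * sgn A' y) ->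
  forall y, fourier e (sgn A') y = c * sgn A y.
Proof.
move=> c2 AA' y; have c_neq0 : c != 0.
  rewrite -sqrf_eq0 c2 oppr_eq0 pnatr_eq0 -lt0n.
  by apply/card_gt0P; exists 0.
apply: (mulfI c_neq0); rewrite mulrA -expr2 c2 mulNr -mulrN -sgnN.
rewrite -(fourier_inversion e_bichar) opprK /fourier mulr_sumr.
by apply: eq_bigr => x _; rewrite -/(fourier e _ x) AA' mulrA.
Qed.

Lemma skew_hadamard_skew D : skew_hadamard D -> skew_set D.
Proof.
case=> _ D0 _ D_disj /setP cover x; have := cover x.
rewrite !inE mem_opp_set; have := @disjointFr _ _ _ x D_disj; rewrite mem_opp_set.
have [->|_] := eqVneq x 0; first by rewrite oppr0 (negPf D0).
by case: (_ \in D) => [/(_ isT) ->|_ /= ->].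
Qed.

(** Counting pairs in $D$ gives $|D|^2 = |D| + 2|D|\lambda$, hence $|D| = 2\lambda+1$ and $v =
    2|D|+1 = 4\lambda+3$. *)
Lemma skew_hadamard_nu D g : skew_hadamard D -> g != 0 ->
  #|V| = (4 * nu D g + 3)%N.
Proof.
move=> sD g_neq0; have skD := skew_hadamard_skew sD; case: sD.
case=> k [lam [_ _ nuD]] _ _ _ _; rewrite nuD //.
have := sum_nu D; rewrite (bigD1 0) //= nu0.
rewrite (eq_bigr (fun=> lam)) => [|x /nuD //]; rewrite sum_nat_const.
have -> : #|[pred x : V | x != 0]| = #|D|.*2.
  apply: succn_inj; rewrite -(card_skew skD) -cardsT [RHS](cardsD1 0) inE add1n.
  by congr _.+1; apply/eq_card => x; rewrite !inE andbT.
(* Needed to cancel $|D|$; the nonzero [g] rules out a trivial group. *)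
have : (0 < #|D|)%N.
  have : (1 < #|V|)%N by rewrite (cardD1 0) (cardD1 g) !inE g_neq0.
  by rewrite (card_skew skD); case: #|D|.
rewrite (card_skew skD) -mulnn -muln2 -mulnA -mulnS => D_gt0 /eqP.
by rewrite eqn_pmul2l // => /eqP <-; lia.
Qed.

(** With $z=\chi_y(D)$, skewness gives $\bar z = -1-z$ and the difference property gives $4|z|^2 =
    v+1$. So $(2z+1)^2 = 1 - 4z\bar z = -v$. *)
Lemma skew_hadamard_char_sum D y : skew_hadamard D -> y != 0 ->
  (2 * char_sum (e y) D + 1) ^+ 2 = - #|V|%:R.
Proof.
move=> sD y_neq0; have skD := skew_hadamard_skew sD.
set z := char_sum _ _.
have z_conj : z^* = - 1 - z.
  have := skew_char_sum y skD; rewrite (negPf y_neq0) mulr0 sub0r -/z.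
  have := skew_char_sum (- y) skD; rewrite oppr_eq0 (negPf y_neq0) mulr0 sub0r.
  rewrite char_sumN // -/z fourier_sgnN.
  move=> eq1 eq2; apply: (@mulfI _ 2); first by rewrite pnatr_eq0.
  by rewrite eq1 mulrBr eq2; ring.
have norm_z : 4 * `|z| ^+ 2 = #|V|%:R + 1.
  rewrite -(fourier_nu e_bichar) /fourier (bigD1 0) //= nu0.
  have [lam nuD] : exists lam, forall g, g != 0 -> nu D g = lam.
    by case: sD => -[k [lam [_ _ nuD]]] _ _ _ _; exists lam.
  rewrite (eq_bigr (fun x => lam%:R * e y x)) => [|x /nuD -> //].
  (* The characters at nonzero points sum to $-1$, so $|z|^2 = |D|-\lambda = \lambda+1$. *)
  have := sum_bicharacter e_bichar y; rewrite (negPf y_neq0) mulr0.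
  rewrite (bigD1 0) //= -mulr_sumr; case: (e_bichar) => _ _ _ -> _.
  move/eqP; rewrite addr_eq0 -eqr_oppLR => /eqP <-.
  have := skew_hadamard_nu sD y_neq0; rewrite nuD // => cardV.
  have cardD : #|D| = (2 * lam + 1)%N by have := card_skew skD; lia.
  by rewrite cardD cardV; ring.
move: norm_z; rewrite normCK z_conj => norm_z.
by rewrite -[#|V|%:R](addrK 1) -norm_z; ring.
Qed.

(** For nonzero $y$ the transform of $s_D$ is a square root of $-v$, so it is $c$ or $-c$, and it is
    odd in $y$; [D'] collects the nonzero points where it equals $c$. *)
Lemma dual_skew_hadamard D c : skew_hadamard D -> c ^+ 2 = - #|V|%:R ->
  let D' := [set a | char_sum (e a) D == (-1 + c) / 2] in
  skew_set D' /\ forall y, fourier e (sgn D) y = c * sgn D' y.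
Proof.
move=> sD c2 D'; have skD := skew_hadamard_skew sD.
have V_neq0 : #|V|%:R != 0 :> algC.
  by rewrite pnatr_eq0 -lt0n; apply/card_gt0P; exists 0.
have c_neq0 : c != 0 by rewrite -sqrf_eq0 c2 oppr_eq0.
have n2 : 2 != 0 :> algC by rewrite pnatr_eq0.
have inD' y : (y \in D') = (fourier e (sgn D) y + #|V|%:R * (y == 0)%:R == c).
  rewrite inE -(inj_eq (mulfI n2)) skew_char_sum // [RHS]eq_sym.
  rewrite mulrCA divff // mulr1 addrAC [-1 + c]addrC (inj_eq (addIr _)).
  by rewrite addrC eq_sym.
have f0 : fourier e (sgn D) 0 = 0.
  by have /eqP := fourier_sgnN D 0; rewrite oppr0 -addr_eq0 -mulr2n mulrn_eq0 => /eqP.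
(* Membership of 0 would mean $c = v$, hence $v^2+v=0$. *)
have D'0 : 0 \notin D'.
  rewrite inD' f0 eqxx add0r mulr1; apply/eqP => Vc.
  have := c2; rewrite -Vc => /eqP; rewrite -addr_eq0 -natrX -natrD pnatr_eq0.
  by rewrite addn_eq0 andbC -[#|V| == _](pnatr_eq0 algC) (negPf V_neq0).
have cNc : (- c == c) = false.
  by rewrite eqNr (negPf c_neq0).
have caseD' y : y != 0 -> ((y \in D') && (- y \notin D') && (fourier e (sgn D) y == c))
   || ((y \notin D') && (- y \in D') && (fourier e (sgn D) y == - c)).
  move=> y_neq0; rewrite !inD' fourier_sgnN oppr_eq0 (negPf y_neq0) mulr0 !addr0.
  have := skew_hadamard_char_sum sD y_neq0; rewrite skew_char_sum //.
  rewrite (negPf y_neq0) mulr0 sub0r addrAC addNr add0r -c2 => /eqP.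
  by rewrite eqf_sqr => /orP[] /eqP ->; rewrite ?opprK !eqxx ?cNc.
split=> [x|x]; have [->|x_neq0] := eqVneq x 0.
- by rewrite oppr0 (negPf D'0).
- by case/orP: (caseD' x x_neq0) => /andP[/andP[]]; do 2!case: (_ \in D').
- by rewrite f0 /sgn oppr0 subrr mulr0.
rewrite /sgn; case/orP: (caseD' x x_neq0) => /andP[/andP[]].
  by move=> -> /negPf-> /eqP->; rewrite subr0 mulr1.
by move=> /negPf-> -> /eqP->; rewrite sub0r mulrN1.
Qed.

(** The case split on the right is that of [nu_cross] for the sets $D$ and $-D$, so the two can be
    compared directly. *)
Lemma norm_dual_char_sum D D' c x y :
  skew_hadamard D -> skew_set D' -> c ^+ 2 = - #|V|%:R -> c^* = - c ->
  (forall z, fourier e (sgn D') z = c * sgn D z) ->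
  `|1 + (char_sum (e y) D' + char_sum (e x) D')| ^+ 2 =
  #|V|%:R * (if x == 0 then if y == 0 then #|V| else (nu D y).+1
             else if y == 0 then (nu D x).+1
             else ((- x \in D) && (- y \in D) + ((x \in D) && (y \in D)))%N)%:R.
Proof.
move=> sD skD' c2 cJ D'D; have skD := skew_hadamard_skew sD.
set z := 1 + _; set N : algC := #|V|%:R * ((y == 0)%:R + (x == 0)%:R).
set s : algC := sgn D y + sgn D x.
have z2 : 2 * z = N + c * s.
  by rewrite /z mulrDr [2 * (_ + _)]mulrDr !skew_char_sum // !D'D /N /s; ring.
have sgnJ t : (sgn D t)^* = sgn D t by rewrite rmorphB !rmorph_nat.
have z2J : 2 * z^* = N - c * s.
  have NJ : N^* = N by rewrite /N rmorphM rmorphD /= !rmorph_nat.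
  have sJ : s^* = s by rewrite /s rmorphD /= !sgnJ.
  have := congr1 Num.conj z2; rewrite [X in X = _]rmorphM [X in _ = X]rmorphD.
  by rewrite [X in _ = _ + X]rmorphM /= rmorph_nat NJ sJ cJ mulNr.
have n4 : 4 != 0 :> algC by rewrite pnatr_eq0.
apply: (mulfI n4).
(* [N] and [s] are real and [c] is purely imaginary, so [N] and [c * s] are the real and imaginary
   parts of $2z$. *)
have -> : 4 * `|z| ^+ 2 = N ^+ 2 + #|V|%:R * s ^+ 2.
  rewrite normCK; transitivity ((2 * z) * (2 * z^*)); first by ring.
  by rewrite z2 z2J -[#|_|%:R]opprK -c2; ring.
have nuD t : t != 0 -> (4 * (nu D t).+1%:R : algC) = #|V|%:R + 1.
  by move=> t0; rewrite (skew_hadamard_nu sD t0) -natr1; ring.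
rewrite /N /s /sgn [RHS]mulrCA; move: #|V| nuD => v nuD.
(* The values of $(N,s)$ are $(2v,0)$ when both points vanish, $(v,\pm1)$ when one does, and $N=0$
   with $s\in\{0,\pm2\}$ otherwise. *)
have [->|x0] := eqVneq x 0; have [->|y0] := eqVneq y 0;
  rewrite ?oppr0 ?(negPf (skew0 skD)) ?nuD ?skewN //=;
  by case: (x \in D); case: (y \in D) => /=; ring.
Qed.

End SkewSets.

(** * Crosses on two complementary subgroups *)

Section Cross.

Variables (V W : finZmodType) (f g : {additive V -> W}).
Implicit Types A B : {set V}.

Definition cross A B : {set W} :=
  [set 0] :|: [set f x | x in A] :|: [set g x | x in B].

Definition complementary : Prop :=
  (forall x y, f x + g y = 0 -> x = 0 /\ y = 0) /\
  (forall w, exists x y, w = f x + g y).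

Hypothesis fgP : complementary.

Lemma complementary_inj x y x' y' :
  f x + g y = f x' + g y' -> x = x' /\ y = y'.
Proof.
move=> /eqP; rewrite -subr_eq0 opprD addrACA -!raddfB => /eqP /fgP.1[].
by move=> /eqP + /eqP; rewrite !subr_eq0 => /eqP -> /eqP ->.
Qed.

Lemma in_cross A B x y :
  (f x + g y \in cross A B) =
  [|| (x == 0) && (y == 0), (x \in A) && (y == 0) | (x == 0) && (y \in B)].
Proof.
rewrite !inE -orbA; congr [|| _, _ | _].
- apply/eqP/andP => [/fgP.1[-> ->] //|[/eqP-> /eqP->]].
  by rewrite !raddf0 addr0.
- apply/imsetP/andP => [[z Az]|[Ax /eqP->]]; last first.
    by exists x => //; rewrite raddf0 addr0.
  by rewrite -[f z]addr0 -(raddf0 g) => /complementary_inj[-> ->].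
apply/imsetP/andP => [[z Bz]|[/eqP-> By]]; last first.
  by exists y => //; rewrite raddf0 add0r.
by rewrite -[g z]add0r -(raddf0 f) => /complementary_inj[-> ->].
Qed.

(** The origin and the two arms are disjoint and [f], [g] are injective. Cardinalities, difference
    counts and character sums all go through this splitting. *)
Lemma big_cross (R : Type) (idx : R) (op : Monoid.com_law idx) (F : W -> R) A B :
  0 \notin A -> 0 \notin B ->
  \big[op/idx]_(w in cross A B) F w =
  op (F 0) (op (\big[op/idx]_(x in A) F (f x)) (\big[op/idx]_(x in B) F (g x))).
Proof.
move=> A0 B0; rewrite /cross -setUA big_setU1 /=; last first.
  rewrite inE negb_or; apply/andP; split; apply/imsetP => -[x].
    move=> + f0; have [|-> _] := @complementary_inj x 0 0 0; last by rewrite (negPf A0).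
    by rewrite -f0 !raddf0 addr0.
  move=> + g0; have [|_ ->] := @complementary_inj 0 x 0 0; last by rewrite (negPf B0).
  by rewrite -g0 !raddf0 addr0.
rewrite (eq_bigl _ _ (fun w => in_setU w _ _)) bigU /=; last first.
  rewrite disjoints_subset; apply/subsetP => _ /imsetP[x Ax ->]; rewrite inE.
  apply/imsetP => -[y By fg]; have [|x0 _] := @complementary_inj x 0 0 y.
    by rewrite !raddf0 addr0 add0r.
  by rewrite x0 (negPf A0) in Ax.
by rewrite !big_imset //= => x y _ _ xy;
  [have [|_ ->] := @complementary_inj 0 x 0 y | have [|->] := @complementary_inj x 0 y 0];
  rewrite // !raddf0 ?add0r ?addr0.
Qed.

Lemma card_complementary : #|W| = (#|V| ^ 2)%N.
Proof.
rewrite -mulnn -card_prod.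
have h_inj : injective (fun u : V * V => f u.1 + g u.2).
  by move=> [x y] [z t] /= xyzt; have [-> ->] := complementary_inj xyzt.
rewrite -(card_codom h_inj); apply: eq_card => w; rewrite inE; apply/esym.
by have [x [y ->]] := fgP.2 w; apply/codomP; exists (x, y).
Qed.

Lemma card_cross A B : skew_set A -> skew_set B -> #|cross A B| = #|V|.
Proof.
move=> skA skB; rewrite -sum1_card big_cross ?skew0 // !sum1_card.
have := card_skew skB; rewrite (card_skew skA) => -[/double_inj <-].
by rewrite /= addnn.
Qed.

(** If exactly one coordinate is nonzero, both points lie on one arm, origin included. If both are
    nonzero, the points lie on different arms, neither at the origin, and each choice of arms fixes
    the pair. *)
Lemma nu_cross A B x y : skew_set A -> skew_set B ->
  nu (cross A B) (f x + g y) =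
  if x == 0 then if y == 0 then #|V| else (nu B y).+1
  else if y == 0 then (nu A x).+1
  else ((- x \in A) && (y \in B) + ((x \in A) && (- y \in B)))%N.
Proof.
move=> skA skB.
have [A0 B0] := (skew0 skA, skew0 skB).
have [/andP[/eqP-> /eqP->]|xy_neq0] := boolP ((x == 0) && (y == 0)).
  by rewrite !raddf0 addr0 nu0 card_cross // eqxx.
rewrite nuE big_cross //= add0r in_cross.
under eq_bigr do rewrite addrA -raddfD in_cross.
under [X in (_ + (_ + X))%N]eq_bigr do rewrite addrCA -raddfD in_cross.
have sum_pt (C : {set V}) z (b : bool) :
    (\sum_(t in C) ((t + z == 0)%R && b) = (- z \in C) && b :> nat)%N.
  rewrite big_mkcond (bigD1 (- z)) //= addNr eqxx /= big1 ?addn0 => [|t /negPf tz].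
    by case: (_ \in C).
  by rewrite addr_eq0 tz if_same.
(* The origin can be the start (when $z\in C$) or the end (when $-z\in C$) of a difference $z$; by
   skewness exactly one happens, whence the successor. *)
have nu_succ (C : {set V}) z : skew_set C -> z != 0 ->
   ((z \in C) + \sum_(t in C) ((t + z == 0)%R || ((t + z)%R \in C)) = (nu C z).+1)%N.
  move=> skC z0; rewrite nuE.
  rewrite (eq_bigr (fun t => ((t + z == 0)%R && true) + ((t + z)%R \in C))%N) => [|t _].
    rewrite big_split /= sum_pt andbT addnA skC z0 //.
  by case: eqP => [->|//]; rewrite (negPf (skew0 skC)).
move: xy_neq0; have [->|x0] := eqVneq x 0; have [->|y0] := eqVneq y 0 => //= _.
- rewrite -(nu_succ B) // (negPf A0) /= big1 ?add0n // => t tA.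
  by rewrite addr0 !andbF; case: eqP tA => // ->; rewrite (negPf A0).
- rewrite -(nu_succ A) // andbT orbF [X in (_ + (_ + X))%N]big1 => [|t tB].
    rewrite addn0; congr (_ + _)%N; apply: eq_bigr => t _.
    by rewrite (negPf B0) !andbT andbF orbF.
  by rewrite addr0 orbF; case: eqP tB => [->|]; rewrite ?andbF ?(negPf B0).
rewrite andbF add0n; congr (_ + _)%N.
  by rewrite -sum_pt; apply: eq_bigr => t _; rewrite !andbF.
by rewrite andbC -sum_pt; apply: eq_bigr => t _; rewrite orbF andbC.
Qed.

Lemma cross_primitive A B : skew_set A -> skew_set B -> primitive_set (cross A B).
Proof.
move=> skA skB; have X0 : 0 \in cross A B by rewrite !inE eqxx.
split=> [H w [H0 HB] | H C [H0 HB] H_neq0].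
  rewrite properE subsetT /= => /subsetPn[u _]; apply: contraNN => /subsetP subX.
  have HN z : z \in H -> - z \in H by move=> Hz; rewrite -sub0r HB.
  have HD z t : z \in H -> t \in H -> z + t \in H.
    by move=> Hz Ht; rewrite -[t]opprK HB // HN.
  (* Since the cross contains 0, the coset is [H] itself. *)
  have Hw : w \in H.
    have /imsetP[h Hh /esym/eqP] := subX 0 X0.
    by rewrite addrC addr_eq0 => /eqP ->; exact: HN.
  have {}subX z : z \in cross A B -> z \in H.
    by move=> /subX/imsetP[h Hh ->]; exact: HD.
  (* For nonzero [x], one of [x], [- x] is in [A], so [H] contains [f x]; likewise [g y]. Thus [H]
     is everything. *)
  have [x [y ->]] := fgP.2 u; apply: HD.
    have [->|x0] := eqVneq x 0; first by rewrite raddf0.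
    have [Ax|] := boolP (x \in A).
      by rewrite subX // -[f x]addr0 -(raddf0 g) in_cross eqxx Ax orbT.
    rewrite -(skewN skA x0) => Ax.
    rewrite -[f x]opprK HN // -raddfN subX //.
    by rewrite -[f _]addr0 -(raddf0 g) in_cross eqxx Ax orbT.
  have [->|y0] := eqVneq y 0; first by rewrite raddf0.
  have [By|] := boolP (y \in B).
    by rewrite subX // -[g y]add0r -(raddf0 f) in_cross eqxx By !orbT.
  rewrite -(skewN skB y0) => By.
  rewrite -[g y]opprK HN // -raddfN subX //.
  by rewrite -[g _]add0r -(raddf0 f) in_cross eqxx By !orbT.
apply: contra H_neq0 => /eqP X_def.
have HN z : z \in H -> - z \in H by move=> Hz; rewrite -sub0r HB.
(* The coset in the union that contains 0 is [H], so [H] lies inside the cross. *)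
have subX z : z \in H -> z \in cross A B.
  move=> Hz; have := X0; rewrite X_def => /bigcupP[b Cb /imsetP[h Hh hb]].
  apply/bigcupP; exists b => //; apply/imsetP; exists (z + h).
    by rewrite -[h]opprK HB // HN.
  by rewrite -addrA -hb addr0.
apply/eqP/setP => z; rewrite inE; apply/idP/eqP => [Hz|->//].
(* Both [z] and [- z] lie in the cross, which skewness of the arms allows only for 0. *)
have := subX _ Hz; have := subX _ (HN _ Hz); have [x [y ->]] := fgP.2 z.
rewrite opprD -!raddfN !in_cross !oppr_eq0; have := skA x; have := skB y.
have [->|_] := eqVneq x 0; have [->|_] := eqVneq y 0; rewrite ?raddf0 ?addr0 //=.
- by rewrite (negPf (skew0 skA)) /=; do 2!case: (_ \in B).
- by rewrite !andbT !orbF; do 2!case: (_ \in A).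
by rewrite !andbF.
Qed.

End Cross.

(** * Direction vectors in the plane over a field *)

Section PlaneLinearAlgebra.

Variable F : fieldType.

(** Cramer's rule; the product of equations acts as a single rewriting rule. *)
Lemma cramer2 (u1 u2 w1 w2 a b : F) (d := u1 * w2 - u2 * w1) : d != 0 ->
  (a = u1 * (d^-1 * (w2 * a - w1 * b)) + w1 * (d^-1 * (u1 * b - u2 * a))) *
  (b = u2 * (d^-1 * (w2 * a - w1 * b)) + w2 * (d^-1 * (u1 * b - u2 * a))).
Proof. by move=> d0; split; rewrite /d; field. Qed.

Variables alpha beta : F.
Hypothesis alpha_neq_beta : alpha != beta.

Lemma dual_slopes_det :
  alpha / (alpha - beta) * (1 / (beta - alpha)) -
  1 / (beta - alpha) * (beta / (alpha - beta)) != 0.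
Proof.
have ab0 : alpha - beta != 0 by rewrite subr_eq0.
have ba0 : beta - alpha != 0 by rewrite subr_eq0 eq_sym.
have -> : alpha / (alpha - beta) * (1 / (beta - alpha)) -
  1 / (beta - alpha) * (beta / (alpha - beta)) = (beta - alpha)^-1.
  by field; rewrite ab0 ba0.
by rewrite invr_eq0.
Qed.

(** The directions of $T$ are, up to order and a sign, the basis dual to $(1,\alpha),(1,\beta)$.
    Paired with $g(1,\alpha)+h(1,\beta)$ they give $h$ and $-g$. *)
Lemma dual_slopes (g h : F) :
  (alpha / (alpha - beta) * (g + h) +
     (beta - alpha)^-1 * (alpha * g + beta * h) = h) *
  (beta / (alpha - beta) * (g + h) +
     (beta - alpha)^-1 * (alpha * g + beta * h) = - g).
Proof.
have ab0 : alpha - beta != 0 by rewrite subr_eq0.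
have ba0 : beta - alpha != 0 by rewrite subr_eq0 eq_sym.
by split; field; rewrite ab0 ba0.
Qed.

End PlaneLinearAlgebra.

(** * Rays in $\mathbb{Z}_p^m\times\mathbb{Z}_p^m$ and the standard characters *)

Section Ray.

Variables (p m : nat).

(** With $G$ seen as $\mathbb{F}_p^2\otimes\mathbb{F}_p^m$, this is $x\mapsto u\otimes x$. *)
Definition ray (u : 'F_p * 'F_p) (x : 'rV['F_p]_m) : 'rV['F_p]_m * 'rV['F_p]_m :=
  (u.1 *: x, u.2 *: x).

Fact ray_additive u : additive (ray u).
Proof. by move=> x y; rewrite /ray !scalerBr. Qed.
HB.instance Definition _ u :=
  GRing.isAdditive.Build 'rV['F_p]_m ('rV['F_p]_m * 'rV['F_p]_m)%type (ray u) (ray_additive u).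

Lemma ray_complementary u w : u.1 * w.2 - u.2 * w.1 != 0 ->
  complementary (ray u) (ray w).
Proof.
set d := _ - _ => d0; split=> [x y [] eq1 eq2|[x y]].
  have dx : d *: x = w.2 *: (u.1 *: x + w.1 *: y) - w.1 *: (u.2 *: x + w.2 *: y).
    by apply/rowP => i; rewrite !mxE /d; ring.
  have dy : d *: y = u.1 *: (u.2 *: x + w.2 *: y) - u.2 *: (u.1 *: x + w.1 *: y).
    by apply/rowP => i; rewrite !mxE /d; ring.
  rewrite eq1 eq2 !scaler0 subrr in dx; rewrite eq1 eq2 !scaler0 subrr in dy.
  by move/eqP: dx; move/eqP: dy; rewrite !scaler_eq0 (negPf d0) => /eqP -> /eqP ->.
exists (d^-1 *: (w.2 *: x - w.1 *: y)), (d^-1 *: (u.1 *: y - u.2 *: x)).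
by congr (_, _); apply/rowP => i; rewrite !mxE -(cramer2 _ _ d0).
Qed.

Section Characters.
Variable zeta : algC.
Hypotheses (p_prime : prime p) (zeta_prim : p.-primitive_root zeta).

Lemma expFpD (u v : 'F_p) : zeta ^+ (u + v : 'F_p)%R = zeta ^+ u * zeta ^+ v.
Proof.
by rewrite /= expr_mod ?exprD // Fp_cast // (prim_expr_order zeta_prim).
Qed.

Lemma expFpN (u : 'F_p) : zeta ^+ (- u : 'F_p)%R = (zeta ^+ u)^*.
Proof.
have norm1 : `|zeta ^+ u| = 1.
  rewrite normrX; have -> : `|zeta| = 1; last by rewrite expr1n.
  apply/eqP; rewrite -(pexpr_eq1 (prim_order_gt0 zeta_prim)) //.
  by rewrite -normrX (prim_expr_order zeta_prim) normr1.
have u0 : zeta ^+ u != 0 by rewrite -normr_eq0 norm1 oner_eq0.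
by apply: (mulIf u0); rewrite -expFpD addNr mulrC -normCK norm1 expr1n.
Qed.

Lemma chi_bicharacter : bicharacter (@chi p m zeta).
Proof.
split=> [y x x'|x y|y x|y|y y0]; rewrite /chi.
- rewrite -expFpD /dotv -big_split /=; congr (_ ^+ nat_of_ord _).
  by apply: eq_bigr => i _; rewrite mxE mulrDr.
- congr (_ ^+ nat_of_ord _); by apply: eq_bigr => i _; rewrite mulrC.
- rewrite -expFpN /dotv -sumrN; congr (_ ^+ nat_of_ord _).
  by apply: eq_bigr => i _; rewrite mxE mulrN.
- by rewrite /dotv big1 // => i _; rewrite mxE mulr0.
have [i yi0] : exists i, y 0 i != 0.
  apply/existsP; apply: contraNT y0; rewrite negb_exists => /forallP y0.
  by apply/eqP/rowP => i; rewrite mxE; apply/eqP; rewrite -[_ == _]negbK.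
(* The value there is $\zeta^{y_i}$ with $0<y_i<p$, which is not 1. *)
exists (delta_mx 0 i); have -> : dotv y (delta_mx 0 i) = y 0 i.
  rewrite /dotv (bigD1 i) //= big1 => [|j /negPf ji].
    by rewrite mxE !eqxx mulr1 addr0.
  by rewrite mxE ji andbF mulr0.
rewrite -(prim_order_dvd zeta_prim) gtnNdvd ?lt0n //.
by rewrite -[X in (_ < X)%N](Fp_cast p_prime).
Qed.

Lemma chi2_bicharacter : bicharacter (@chi2 p m zeta).
Proof.
have [cD cC cN c0 c_nondeg] := chi_bicharacter.
split=> [y x x'|x y|y x|y|[a b] ab0]; rewrite /chi2 /=.
- by rewrite !cD mulrACA.
- by rewrite cC [X in _ * X]cC.
- by rewrite !cN rmorphM.
- by rewrite !c0 mulr1.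
have [a0|/c_nondeg[x x1]] := eqVneq a 0; last by exists (x, 0); rewrite c0 mulr1.
have [b0|/c_nondeg[x x1]] := eqVneq b 0; last by exists (0, x); rewrite c0 mul1r.
by rewrite a0 b0 eqxx in ab0.
Qed.

Lemma chi_scale (a x : 'rV['F_p]_m) c : chi zeta a (c *: x) = chi zeta (c *: a) x.
Proof.
congr (_ ^+ nat_of_ord _); apply: eq_bigr => i _.
by rewrite !mxE mulrCA mulrA.
Qed.

(** Scalars move across the inner product, so a character of $G$ restricts on a ray to a character
    of $\mathbb{Z}_p^m$. *)
Lemma chi2_ray (ab : 'rV['F_p]_m * 'rV['F_p]_m) u x :
  chi2 zeta ab (ray u x) = chi zeta (u.1 *: ab.1 + u.2 *: ab.2) x.
Proof.
have [cD cC _ _ _] := chi_bicharacter.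
by rewrite /chi2 !chi_scale cC [X in _ * X]cC -cD cC.
Qed.

End Characters.
End Ray.

(** * The dual pair as two crosses *)

Theorem theorem3p20 (p m : nat) (zeta : algC) (D : {set 'rV['F_p]_m})
    (alpha beta : 'F_p)
    (p_prime : prime p) (m_ge1 : (1 <= m)%N)
    (v_mod4 : (p ^ m = 3 %[mod 4])%N)
    (zeta_prim : p.-primitive_root zeta)
    (D_skew : skew_hadamard D)
    (alpha_neq0 : alpha != 0) (beta_neq0 : beta != 0)
    (alpha_neq_beta : alpha != beta) :
  let Dstar := dual_set zeta D in
  let S : {set 'rV['F_p]_m * 'rV['F_p]_m} :=
    [set (0, 0)]
    :|: [set (x, alpha *: x) | x in D]
    :|: [set (x, beta *: x) | x in opp_set D] in
  let T : {set 'rV['F_p]_m * 'rV['F_p]_m} :=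
    [set (0, 0)]
    :|: [set ((alpha / (alpha - beta)) *: x, (1 / (beta - alpha)) *: x)
          | x in Dstar]
    :|: [set ((beta / (alpha - beta)) *: x, (1 / (beta - alpha)) *: x)
          | x in opp_set Dstar] in
  primitive_formally_dual_pair (@chi2 p m zeta) S T.
Proof.
set V := 'rV['F_p]_m.
have chiP := chi_bicharacter m p_prime zeta_prim.
have chi2P := chi2_bicharacter m p_prime zeta_prim.
have cardV : #|{: V}| = (p ^ m)%N by rewrite card_mx card_Fp // mul1n.
move=> Dstar S T.
set c : algC := 'i * sqrtC (p ^ m)%N%:R.
have c2 : c ^+ 2 = - #|{: V}|%:R by rewrite exprMn sqrCi sqrtCK mulN1r cardV.
have cJ : c^* = - c.
  rewrite /c rmorphM /=.
  by rewrite conjCi conj_Creal ?mulNr // realE sqrtC_ge0 ler0n.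
have skD := skew_hadamard_skew D_skew.
have [skDs DDs] : skew_set Dstar /\
    forall y, fourier (chi zeta) (sgn D) y = c * sgn Dstar y.
  exact: dual_skew_hadamard.
have sgnDs := fourier_sgn_dual chiP c2 DDs.
pose u1 := (1, alpha) : 'F_p * 'F_p; pose u2 := (1, beta) : 'F_p * 'F_p.
pose w1 := (alpha / (alpha - beta), 1 / (beta - alpha)) : 'F_p * 'F_p.
pose w2 := (beta / (alpha - beta), 1 / (beta - alpha)) : 'F_p * 'F_p.
have uP : complementary (@ray p m u1) (@ray p m u2).
  by apply: ray_complementary; rewrite /= mul1r mulr1 subr_eq0 eq_sym.
have wP : complementary (@ray p m w1) (@ray p m w2).
  exact/ray_complementary/dual_slopes_det.
have SE : S = cross (@ray p m u1) (@ray p m u2) D (opp_set D).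
  by congr (_ :|: _ :|: _); apply: eq_imset => x; rewrite /= /ray scale1r.
have TE : T = cross (@ray p m w1) (@ray p m w2) Dstar (opp_set Dstar) by [].
move: S T SE TE => _ _ -> ->.
have skDN := skew_opp_set skD; have skDsN := skew_opp_set skDs.
split; [|exact: cross_primitive | exact: cross_primitive].
have V_gt0 : (0 < #|{: V}|)%N by apply/card_gt0P; exists 0.
apply: (formally_dual_pair_half chi2P); rewrite ?card_cross //.
  by rewrite (card_complementary uP) mulnn.
(* The frequency is decomposed along the arms of $S$, the coordinates in which [nu_cross] counts. *)
move=> y; have [g [h ->]] := uP.2 y; rewrite nu_cross //.
have charT : char_sum (chi2 zeta (@ray p m u1 g + @ray p m u2 h))
    (cross (@ray p m w1) (@ray p m w2) Dstar (opp_set Dstar)) =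
    1 + (char_sum (chi zeta h) Dstar + char_sum (chi zeta g) Dstar).
  rewrite {1}/char_sum big_cross ?skew0 //=.
  have [_ _ _ -> _] := chi2P; congr (_ + (_ + _)).
    apply: eq_bigr => x _; rewrite (chi2_ray p_prime zeta_prim); congr (chi _ _ _).
    by apply/rowP => i; rewrite !mxE /= !mul1r dual_slopes.
  (* The second arm of $T$ sees the character at $-g$, and summing it over $-D^*$ equals summing the
     one at $g$ over $D^*$. *)
  rewrite -[g in RHS]opprK -(char_sum_opp_set chiP).
  apply: eq_bigr => x _; rewrite (chi2_ray p_prime zeta_prim); congr (chi _ _ _).
  by apply/rowP => i; rewrite !mxE /= !mul1r dual_slopes.
rewrite charT (norm_dual_char_sum chiP _ _ D_skew skDs c2 cJ sgnDs).
(* Both sets have $v$ elements, so $|T|^2/|S|$ is the factor $v$ of [norm_dual_char_sum]. *)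
by rewrite expr2 mulfK ?pnatr_eq0 -?lt0n // !mem_opp_set opprK nu_opp_set.
Qed.
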